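(* Every order type $\lambda$ is binary arithmetisable and has a binary density $db(\lambda)$ which is an ordinal number. That is, for every linearly ordered set $\lambda$ there is an ordinal $\alpha$ such that $\lambda$ is order-embeddable in the binary tree $D_\alpha$ of height $\alpha$, and consequently there is a least such ordinal, $db(\lambda)$.
   Context: For an ordinal $\alpha$, the binary tree $D_\alpha$ of height $\alpha$ is taken to be the set of $0$-$1$ sequences $(x_\xi)_{\xi<\alpha}$ with its linear (lexicographic) ordering. An order type is binary arithmetisable if it is order-embeddable in some $D_\alpha$. The binary density $db(\lambda)$ of $\lambda$ is the least ordinal $\alpha$ such that $\lambda$ is order-embeddable in $D_\alpha$. *)

(* Defs.v *)
From HB Require Import structures.
From mathcomp Require Import all_boot all_order.
From mathcomp Require Import boolp wochoice.

Set Implicit Arguments.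
Unset Strict Implicit.
Unset Printing Implicit Defensive.
Import Order.TTheory.
Local Open Scope order_scope.

(* An ordinal number is represented by a well-ordered set, two of them denoting
   the same ordinal when they are isomorphic ([same_ordinal]). The empty
   carrier is allowed and represents 0. *)
Record ordinal_number : Type := OrdinalNumber {
  ord_disp : Order.disp_t;
  ord_carrier :> orderType ord_disp;
  ord_wo : well_order (<=%O : rel ord_carrier) }.

Definition order_embeds d d' (L : orderType d) (M : orderType d') : Prop :=
  exists f : L -> M, {mono f : x y / x <= y}.

Definition same_ordinal (a b : ordinal_number) : Prop :=
  exists2 f : a -> b, {mono f : x y / x <= y} & bijective f.

(* [a] is at most [b] when [a] is isomorphic to an initial segment of [b]. *)
Definition ordinal_le (a b : ordinal_number) : Prop :=
  exists2 f : a -> b, {mono f : x y / x <= y} &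
    forall (x : a) (y : b), y <= f x -> exists z : a, f z = y.

(* The set of 0-1 sequences of length [a]. The alias keeps the lexicographic
   order apart from the pointwise order that boolp puts on [a -> bool]. *)
Definition binary_tree (a : ordinal_number) : Type := a -> bool.

HB.instance Definition _ (a : ordinal_number) :=
  Choice.copy (binary_tree a) (a -> bool).

Section Lexicographic.
Variable a : ordinal_number.
Implicit Types (x y z : binary_tree a) (xi eta : a).

Definition lex_lt : rel (binary_tree a) := fun x y =>
  `[< exists xi, (forall eta, eta < xi -> x eta = y eta) /\
                 (x xi = false /\ y xi = true) >].

Lemma lex_lt_irr : irreflexive lex_lt.
Proof. by move=> x; apply/asboolP => -[xi [_ [->]]]. Qed.

Lemma lex_lt_trans : transitive lex_lt.
Proof.
move=> y x z /asboolP[i [xy [xi yi]]] /asboolP[j [yz [yj zj]]].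
apply/asboolP; case: (ltgtP i j) => ij.
- exists i; split; last by rewrite -(yz i ij).
  by move=> k ki; rewrite xy // yz // (lt_trans ki).
- exists j; split; last by rewrite (xy j ij).
  by move=> k kj; rewrite xy ?yz // (lt_trans kj).
- by move: yi; rewrite ij yj.
Qed.

HB.instance Definition _ := Order.Lt_isPOrder.Build (ord_disp a) (binary_tree a)
  lex_lt_irr lex_lt_trans.

Lemma lex_total : total (<=%O : rel (binary_tree a)).
Proof.
move=> x y; case: (eqVneq x y) => [->|/eqP nxy]; first by rewrite lexx.
have ne : nonempty [pred i | x i != y i].
  have : ~ forall i, x i = y i by move=> e; apply: nxy; exact/funext.
  by move=> /existsNP[i /eqP]; exists i.
have [i [[ni mi] _]] := ord_wo ne.
have agree k : k < i -> x k = y k.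
  move=> ki; apply/eqP; apply: contraTT ki => nk; rewrite -leNgt.
  exact: mi.
rewrite !le_eqVlt.
case ex: (x i) ni; case ey: (y i); rewrite inE ex ey // => _.
- apply/orP; right; apply/orP; right; apply/asboolP.
  by exists i; split=> // k /agree.
- by apply/orP; left; apply/orP; right; apply/asboolP; exists i.
Qed.

HB.instance Definition _ :=
  Order.POrder_isTotal.Build (ord_disp a) (binary_tree a) lex_total.

End Lexicographic.

Definition binary_arithmetisable d (L : orderType d) : Prop :=
  exists a : ordinal_number, order_embeds L (binary_tree a).

Definition is_binary_density d (L : orderType d) (a : ordinal_number) : Prop :=
  order_embeds L (binary_tree a) /\
  forall b : ordinal_number, order_embeds L (binary_tree b) -> ordinal_le a b.

(* Main.v *)
Require Import Defs.
From mathcomp Require Import all_boot all_order.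
From HB Require Import structures.
From mathcomp Require Import boolp wochoice.

(** Well-order [L] by an unrelated relation and send [x] to the characteristic
    function of [{y | y <= x}]. For [x < z] the image of [x] is pointwise below
    the image of [z] and differs from it at [z], so at the first difference it
    is 0 against 1. The least height exists since any two well-orders are
    comparable: the union of all isomorphisms between initial segments is again
    one, and it could be extended if it were defined on a proper segment of both
    sides. *)

Set Implicit Arguments.
Unset Strict Implicit.
Unset Printing Implicit Defensive.
Import Order.TTheory.
Local Open Scope order_scope.

(* The alias keeps [R] apart from any order that [T] already carries. *)
Definition reordered (T : Type) (R : rel T) (wo : well_order R) : Type := T.

(** * From a well-order to an ordinal number *)

Section Reordered.
Variables (d : Order.disp_t) (T : choiceType) (R : rel T) (wo : well_order R).

HB.instance Definition _ := Choice.copy (reordered wo) T.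

Let wo_chainT : wo_chain R predT.
Proof. by move=> A _; exact: wo. Qed.

Let R_refl : reflexive R.
Proof. by move=> x; exact: (wo_chain_reflexive wo_chainT). Qed.

Let R_anti : antisymmetric R.
Proof. by move=> x y; exact: (wo_chain_antisymmetric wo_chainT). Qed.

Let R_trans : transitive R.
Proof.
move=> y x z Rxy Ryz.
(* Transitivity comes from a least element [m] of the three points: [m = x] is immediate, and
   otherwise antisymmetry identifies two neighbours. *)
have [|m [[/or3P mxyz lbm] _]] := wo (A := [pred u | [|| u == x, u == y | u == z]]).
  by exists x; rewrite inE eqxx.
have Rm u : [|| u == x, u == y | u == z] -> R m u by exact: lbm.
have [Rmx Rmy Rmz] : [/\ R m x, R m y & R m z].
  by split; apply: Rm; rewrite eqxx ?orbT.
case: mxyz => /eqP m_eq; subst m => //.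
- by rewrite (R_anti (introT andP (conj Rxy Rmx))).
- by rewrite -(R_anti (introT andP (conj Ryz Rmy))).
Qed.

Let R_total : total R.
Proof. by move=> x y; exact: (wo_chainW wo_chainT). Qed.

HB.instance Definition _ := Order.Le_isPOrder.Build d (reordered wo)
  R_refl R_anti R_trans.

HB.instance Definition _ :=
  Order.POrder_isTotal.Build d (reordered wo) R_total.

Definition reordered_ordinal : ordinal_number :=
  @OrdinalNumber d (reordered wo) wo.

End Reordered.

Lemma ord_least (a : ordinal_number) (P : a -> Prop) :
  (exists x, P x) -> exists2 x, P x & forall y, y < x -> ~ P y.
Proof.
move=> [x Px].
have [|m [[/asboolP Pm lbm] _]] := ord_wo (A := [pred u : a | `[< P u >]]).
  by exists x; apply/asboolP.
exists m => // y ltym /asboolP Py.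
by have := lbm y Py; rewrite leNgt ltym.
Qed.

Lemma binary_arithmetisableT d (L : orderType d) : binary_arithmetisable L.
Proof.
have [R wo] := well_ordering_principle L.
exists (reordered_ordinal d wo).
exists (fun x => (fun y : L => y <= x) : binary_tree (reordered_ordinal d wo)).
apply: le_mono => x z ltxz.
apply/asboolP.
have [|i ni least] := ord_least (a := reordered_ordinal d wo)
  (P := fun i : L => (i <= x) <> (i <= z)).
  by exists z; rewrite lexx leNgt ltxz.
exists i; split; first by move=> k /least /contrapT.
case leix : ((i : L) <= x) ni; first by rewrite (le_trans leix (ltW ltxz)).
by case: ((i : L) <= z).
Qed.

(** * Comparability and minimality of ordinals *)

Section Comparability.
Implicit Types a b : ordinal_number.

(** The graph of an isomorphism between initial segments; the first clause also makes [R]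
    single-valued and injective. Being a relation, it is easy to invert and to unite with others. *)
Definition segment_iso a b (R : a -> b -> Prop) : Prop :=
  [/\ forall x y x' y', R x y -> R x' y' -> (x <= x') = (y <= y'),
      forall x y x', R x y -> x' < x -> exists y', R x' y' &
      forall x y y', R x y -> y' < y -> exists x', R x' y'].

Lemma segment_iso_flip a b (R : a -> b -> Prop) :
  segment_iso R -> segment_iso (fun y x => R x y).
Proof.
case=> Rle Rdom Rran; split.
- by move=> y x y' x' ? ?; apply/esym/Rle.
- by move=> y x y' Rxy; exact: Rran Rxy.
- by move=> y x x' Rxy; exact: Rdom Rxy.
Qed.

(** At the least [m] where the first value [u] is below the second, [u] is also a value of the
    second relation, at some [m' < m]. The first value at [m'] is then below [u], against
    minimality. *)
Lemma segment_iso_agree a b (R S : a -> b -> Prop) x y y' :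
  segment_iso R -> segment_iso S -> R x y -> S x y' -> y = y'.
Proof.
suff nlt (R' S' : a -> b -> Prop) z w w' : segment_iso R' -> segment_iso S' ->
    R' z w -> S' z w' -> ~ w < w'.
  move=> isoR isoS Rxy Sxy'; case: (ltgtP y y') => // lt.
  - by case: (nlt _ _ _ _ _ isoR isoS Rxy Sxy').
  - by case: (nlt _ _ _ _ _ isoS isoR Sxy' Rxy).
move=> [Rle Rdom _] [Sle _ Sran] R'zw S'zw' ltww'.
have [|m [u [u' [Rmu Smu' ltuu']]] least] := ord_least
  (P := fun m => exists u u', [/\ R' m u, S' m u' & u < u']).
  by exists z, w, w'.
have [m' Sm'u] := Sran _ _ _ Smu' ltuu'.
have ltm'm : m' < m by rewrite ltNge (Sle _ _ _ _ Smu' Sm'u) -ltNge.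
have [v Rm'v] := Rdom _ _ _ Rmu ltm'm.
apply: (least m' ltm'm); exists v, u; split=> //.
by rewrite ltNge -(Rle _ _ _ _ Rmu Rm'v) -ltNge.
Qed.

(** If [x < x'], then [S] is defined at [x] too and agrees there with [R]. This makes the union of
    all segment isomorphisms monotone. *)
Lemma segment_iso_le a b (R S : a -> b -> Prop) x y x' y' :
  segment_iso R -> segment_iso S -> R x y -> S x' y' -> x <= x' -> y <= y'.
Proof.
move=> isoR isoS Rxy Sxy'; rewrite le_eqVlt => /orP[/eqP xx'|ltxx'].
  by rewrite -xx' in Sxy'; rewrite (segment_iso_agree isoR isoS Rxy Sxy').
have [Sle Sdom _] := isoS; have [y1 Sxy1] := Sdom _ _ _ Sxy' ltxx'.
rewrite (segment_iso_agree isoR isoS Rxy Sxy1) -(Sle _ _ _ _ Sxy1 Sxy').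
exact: ltW.
Qed.

Definition max_segment_iso a b (x : a) (y : b) : Prop :=
  exists2 R : a -> b -> Prop, segment_iso R & R x y.

Lemma max_segment_isoP a b : segment_iso (@max_segment_iso a b).
Proof.
split.
- move=> x y x' y' [R isoR Rxy] [S isoS Sxy'].
  apply/idP/idP; first exact: segment_iso_le isoR isoS Rxy Sxy'.
  (* The converse is the same fact for the inverse relations. *)
  exact: segment_iso_le (segment_iso_flip isoR) (segment_iso_flip isoS) Rxy Sxy'.
- move=> x y x' [R isoR Rxy] ltx'x; have [_ Rdom _] := isoR.
  by have [y' Rxy'] := Rdom _ _ _ Rxy ltx'x; exists y', R.
- move=> x y y' [R isoR Rxy] lty'y; have [_ _ Rran] := isoR.
  by have [x' Rxy'] := Rran _ _ _ Rxy lty'y; exists x', R.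
Qed.

Lemma segment_iso_extend a b (R : a -> b -> Prop) x0 y0 :
  segment_iso R ->
  (forall x, x < x0 <-> exists y, R x y) ->
  (forall y, y < y0 <-> exists x, R x y) ->
  segment_iso (fun x y => R x y \/ (x = x0 /\ y = y0)).
Proof.
move=> [Rle Rdom Rran] dom ran.
have ltx0 x y : R x y -> x < x0 by move=> Rxy; apply/dom; exists y.
have lty0 x y : R x y -> y < y0 by move=> Rxy; apply/ran; exists x.
split.
- move=> x y x' y' [Rxy|[-> ->]] [Rxy'|[-> ->]].
  + exact: Rle.
  + by rewrite !ltW ?(ltx0 _ _ Rxy) ?(lty0 _ _ Rxy).
  + by rewrite !leNgt (ltx0 _ _ Rxy') (lty0 _ _ Rxy').
  + by rewrite !lexx.
- move=> x y x' [Rxy|[-> _]] ltx'x.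
  + by have [y' ?] := Rdom _ _ _ Rxy ltx'x; exists y'; left.
  + by have [y' ?] := (dom x').1 ltx'x; exists y'; left.
- move=> x y y' [Rxy|[_ ->]] lty'y.
  + by have [x' ?] := Rran _ _ _ Rxy lty'y; exists x'; left.
  + by have [x' ?] := (ran y').1 lty'y; exists x'; left.
Qed.

(** The domain is closed downwards, so a least missing point bounds it exactly. *)
Lemma segment_iso_dom a b (R : a -> b -> Prop) :
  segment_iso R -> (forall x, exists y, R x y) \/
  exists x0, forall x, x < x0 <-> exists y, R x y.
Proof.
move=> [_ Rdom _]; have [|/existsNP/ord_least[x0 nx0 least]] :=
  pselect (forall x, exists y, R x y); [by left | right].
exists x0 => x; split; first by move=> /least /contrapT.
move=> [y Rxy]; rewrite ltNge; apply/negP; rewrite le_eqVlt => /orP[/eqP xx|lt].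
  by apply: nx0; exists y; rewrite xx.
exact/nx0/(Rdom _ _ _ Rxy).
Qed.

(** Expresses that [a] is strictly smaller than [b], and keeps the endpoint so that ordinals below
    [b] can be compared as points of [b]. *)
Definition initial_segment_at a b (y0 : b) : Prop :=
  exists2 f : a -> b, {mono f : x y / x <= y} &
    forall y, y < y0 <-> exists x, f x = y.

Lemma ordinal_comparable a b :
  ordinal_le a b \/ exists x0 : a, initial_segment_at b x0.
Proof.
have isoU := max_segment_isoP a b; have [Ule Udom Uran] := isoU.
have isoV := segment_iso_flip isoU.
have uniqV (y : b) (x x' : a) : max_segment_iso x y -> max_segment_iso x' y -> x = x'.
  by move=> Uxy Ux'y; exact: (segment_iso_agree isoV isoV Uxy Ux'y).
have [/choice[f Uf]|[x0 dom]] := segment_iso_dom isoU.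
  left; exists f; first by move=> x x'; rewrite -(Ule _ _ _ _ (Uf x) (Uf x')).
  move=> x y; rewrite le_eqVlt => /orP[/eqP ->|/(Uran _ _ _ (Uf x))[z Uzy]].
    by exists x.
  by exists z; exact: (segment_iso_agree isoU isoU (Uf z) Uzy).
right; exists x0.
have [/choice[g Ug]|[y0 ran]] := segment_iso_dom isoV.
  exists g; first by move=> y y'; rewrite (Ule _ _ _ _ (Ug y) (Ug y')).
  move=> x; split; last by move=> [y <-]; apply/dom; exists y.
  by move=> /dom[y Uxy]; exists y; exact: uniqV (Ug y) Uxy.
(* Neither side is exhausted: the union extended by the pair [x0], [y0] is one of the relations
   united, so [x0] is in its domain. *)
suff : x0 < x0 by rewrite ltxx.
apply/dom; exists y0; exists (fun x y => max_segment_iso x y \/ (x = x0 /\ y = y0)).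
  exact: segment_iso_extend.
by right.
Qed.

(** The search takes place inside one witness [a0]: the least endpoint [i] of a segment isomorphic
    to an ordinal in [P] gives the minimum, and without such an endpoint [a0] is the minimum. *)
Lemma ordinal_least (P : ordinal_number -> Prop) :
  (exists a, P a) -> exists2 a, P a & forall b, P b -> ordinal_le a b.
Proof.
move=> [a0 Pa0].
have [|noP] := pselect (exists i : a0, exists2 a, P a & initial_segment_at a i).
  move=> /ord_least[i [a Pa [f fmono fi]] least]; exists a => // b Pb.
  have [//|[x [g gmono gx]]] := ordinal_comparable a b.
  have ltfi : f x < i by apply/fi; exists x.
  (* If [b] were the segment of [a] below [x], then [f] would carry it to the segment of [a0] below
     [f x]. *)
  case: (least _ ltfi); exists b => //; exists (f \o g).
    by move=> u v /=; rewrite fmono gmono.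
  move=> y; split=> [ltyfx|[z <-] /=].
    have [u fu] := (fi y).1 (lt_trans ltyfx ltfi).
    move: ltyfx; rewrite -fu (leW_mono fmono) => /gx[z gz].
    by exists z; rewrite /= gz.
  by rewrite (leW_mono fmono); apply/gx; exists z.
exists a0 => // b Pb; have [//|[x bx]] := ordinal_comparable a0 b.
by case: noP; exists x, b.
Qed.

(** The graphs of [f] and of the inverse of [g] are both segment isomorphisms from [a] to [b], so
    they agree and [g] inverts [f]. *)
Lemma ordinal_le_anti a b : ordinal_le a b -> ordinal_le b a -> same_ordinal a b.
Proof.
move=> [f fmono fini] [g gmono gini].
pose F x y := f x = y; pose G x y := x = g y.
have isoF : segment_iso F.
  split=> [x y x' y' <- <-|x y x' _ _|x y y' <- /ltW /fini[z <-]].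
  - by rewrite fmono.
  - by exists (f x').
  - by exists z.
have isoG : segment_iso G.
  split=> [x y x' y' -> ->|x y x' -> /ltW /gini[z <-]|x y y' _ _].
  - by rewrite gmono.
  - by exists z.
  - by exists (g y').
have fgK : cancel g f.
  by move=> y; exact: (segment_iso_agree isoF isoG (x := g y)).
exists f => //; exists g => // x; apply: (inc_inj fmono).
by rewrite fgK.
Qed.

End Comparability.

Theorem theorem11 (d : Order.disp_t) (L : orderType d) :
  binary_arithmetisable L /\
  exists a : ordinal_number,
    is_binary_density L a /\
    forall b : ordinal_number, is_binary_density L b -> same_ordinal b a.
Proof.
split; first exact: binary_arithmetisableT.
have [a La least] := ordinal_least (binary_arithmetisableT L).
exists a; split=> // b [Lb leastb].
by apply: ordinal_le_anti; [exact: leastb | exact: least].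
Qed.
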